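(* Let $\mathcal{P}\in\mathcal{Q}_n$ be an irreducible, tridiagonal sign pattern with a $0$-diagonal. If $\mathcal{P}_4$ or $(\mathcal{P}_4)_-$ is a submatrix of $\mathcal{P}$, then $\mathcal{P}$ is not consistent, where $$\mathcal{P}_4=\begin{bmatrix}0&+&0&0\\+&0&-&0\\0&+&0&+\\0&0&+&0\end{bmatrix}.$$
   Context: A sign pattern is a matrix with entries in $\{+,-,0\}$; $\mathcal{Q}_n$ is the set of $n\times n$ sign patterns; $\mathcal{Q}(\mathcal{P})$ is the set of real matrices whose entries have the signs prescribed by $\mathcal{P}=[p_{ij}]$. $\mathcal{P}$ is tridiagonal if $p_{ij}=0$ whenever $|i-j|>1$; irreducible tridiagonal means $p_{i,i+1}\neq0$, $p_{i+1,i}\ne0$ for all $i$; $0$-diagonal means $p_{ii}=0$. $\mathcal{P}$ is consistent if there is $k$ such that every $A\in\mathcal{Q}(\mathcal{P})$ has exactly $k$ real eigenvalues (with algebraic multiplicity). For a combinatorially symmetric pattern ($p_{ij}\neq0\iff p_{ji}\ne0$) with $0$-diagonal, its signed undirected graph has vertices $1,\dots,n$, an edge $\{i,j\}$ ($i\ne j$) iff $p_{ij}\neq0$, with sign $p_{ij}p_{ji}$. For a tree sign pattern $\mathcal{P}$ with $0$-diagonal (signed undirected graph a tree), $\mathcal{P}_-$ denotes a sign pattern with the same zero/nonzero pattern whose signed undirected graph is obtained from that of $\mathcal{P}$ by reversing the sign of every edge. Thus $(\mathcal{P}_4)_-$ is a $4\times4$ tridiagonal $0$-diagonal pattern whose path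 edges $\{1,2\},\{2,3\},\{3,4\}$ have signs $-,+,-$. *)

(* Defs.v *)
From HB Require Import structures.
From mathcomp Require Import all_boot all_order all_algebra.
From mathcomp Require Import reals polyrcf.

Set Implicit Arguments.
Unset Strict Implicit.
Unset Printing Implicit Defensive.

Import Order.TTheory GRing.Theory Num.Theory.
Local Open Scope ring_scope.

Inductive sign := Pos | Neg | Zero.

Definition sign_eqb (s t : sign) : bool :=
  match s, t with
  | Pos, Pos | Neg, Neg | Zero, Zero => true
  | _, _ => false
  end.

Lemma sign_eqP : Equality.axiom sign_eqb.
Proof. by case; case; constructor. Qed.

HB.instance Definition _ := hasDecEq.Build sign sign_eqP.

Definition sign_opp (s : sign) : sign :=
  match s with Pos => Neg | Neg => Pos | Zero => Zero end.

Definition sign_mul (s t : sign) : sign :=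
  match s with Pos => t | Neg => sign_opp t | Zero => Zero end.

Definition sign_of (R : realType) (x : R) : sign :=
  if x == 0 then Zero else if 0 < x then Pos else Neg.

Definition qual_class (R : realType) (n : nat) (P : 'M[sign]_n) (A : 'M[R]_n)
  : Prop := forall i j, sign_of (A i j) = P i j.

(* [rootsR] lists each real root once; [mup] restores the multiplicity. *)
Definition num_real_eigenvalues (R : realType) (n : nat) (A : 'M[R]_n) : nat :=
  (\sum_(x <- rootsR (char_poly A)) mup x (char_poly A))%N.

Definition consistent (R : realType) (n : nat) (P : 'M[sign]_n) : Prop :=
  exists k : nat,
    forall A : 'M[R]_n, qual_class P A -> num_real_eigenvalues A = k.

Definition tridiagonal (n : nat) (P : 'M[sign]_n) : Prop :=
  forall i j : 'I_n, (1 < `|i%:Z - j%:Z|)%N -> P i j = Zero.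

Definition irreducible_tridiagonal (n : nat) (P : 'M[sign]_n) : Prop :=
  tridiagonal P /\
  forall i j : 'I_n, j = i.+1 :> nat -> P i j != Zero /\ P j i != Zero.

Definition zero_diagonal (n : nat) (P : 'M[sign]_n) : Prop :=
  forall i, P i i = Zero.

Definition submatrix (m1 n1 m n : nat)
    (B : 'M[sign]_(m1, n1)) (P : 'M[sign]_(m, n)) : Prop :=
  exists (f : 'I_m1 -> 'I_m) (g : 'I_n1 -> 'I_n),
    [/\ {homo f : i j / (i < j)%N}, {homo g : i j / (i < j)%N}
      & mxsub f g P = B].

(* Symmetric, hence an undirected graph, only when [P i j] and [P j i] vanish
   together, which the zero patterns used here guarantee. *)
Definition graph_edge (n : nat) (P : 'M[sign]_n) : rel 'I_n :=
  fun i j => (i != j) && (P i j != Zero).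

Definition edge_sign (n : nat) (P : 'M[sign]_n) (i j : 'I_n) : sign :=
  sign_mul (P i j) (P j i).

(* [P_-] is determined only through its signed graph, so it is a relation:
   [Q] is a choice of [P_-]. *)
Definition edge_sign_reversal (n : nat) (P Q : 'M[sign]_n) : Prop :=
  (forall i j, (Q i j == Zero) = (P i j == Zero)) /\
  (forall i j, graph_edge P i j ->
     edge_sign Q i j = sign_opp (edge_sign P i j)).

Definition P4 : 'M[sign]_4 :=
  \matrix_(i < 4, j < 4)
    nth Zero (nth [::] [:: [:: Zero; Pos;  Zero; Zero];
                           [:: Pos;  Zero; Neg;  Zero];
                           [:: Zero; Pos;  Zero; Pos];
                           [:: Zero; Zero; Pos;  Zero]] i) j.

(* Main.v *)
(** Up to diagonal similarity a 0-diagonal tridiagonal matrix is determined by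
    the products [a] of opposite entries along the edges of the path, and
    [p_(m+1) = x p_m - a_m p_(m-1)] computes its characteristic polynomial,
    which has the form [f(x^2)] or [x f(x^2)].  Extending the path by an edge
    whose product is tiny creates at most one new root of [f], a real one near
    0, whose sign depends only on the signs of the edges; all other roots keep
    their signs.  Hence all roots of [f] can be kept real, and the number of
    real eigenvalues is governed by the number of positive ones.  Across three
    edges of signs [+,-,+] or [-,+,-], behind a tiny connecting edge, [f] gets
    multiplied up to a small perturbation by [y^2 - (a+b+c) y + a c], whose
    roots can be chosen both positive (2d, 3d) or both negative (-2d, -3d)
    according to the sign of [a + b + c].  Both choices affect later extensions
    in the same way, so the numbers of positive roots stay different. *)

Require Import Defs.
From mathcomp Require Import all_boot all_order all_algebra.
From mathcomp Require Import reals polyrcf.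
From mathcomp Require Import zify ring lra.

Set Implicit Arguments.
Unset Strict Implicit.
Unset Printing Implicit Defensive.

Import Order.TTheory GRing.Theory Num.Theory.
Local Open Scope ring_scope.

(** * Sign alternations as robust witnesses of real roots *)

Section Alternation.
Variable R : rcfType.
Implicit Types (f q F : {poly R}) (e k c : R) (s : seq R).

(** Used with [e] equal to 1 or -1: the points run to the right or to the left. Strict sign changes
    at finitely many points stand in for roots because they survive small perturbations of [f]. *)
Definition alternating f e : R -> seq R -> bool :=
  path [rel a b | (e * a < e * b) && (Num.sg f.[b] == - Num.sg f.[a])].

Lemma alternating_gt f e x s :
  alternating f e x s -> all (fun t => e * x < e * t) s.
Proof.
elim: s x => //= b s IHs x /andP[/andP[lt_xb _] alt_s].
rewrite lt_xb; apply: sub_all (IHs _ alt_s) => t; exact: lt_trans.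
Qed.

Lemma alternating_neq0 f e x s :
  f.[x] != 0 -> alternating f e x s -> all (fun t => f.[t] != 0) (x :: s).
Proof.
elim: s x => [|b s IHs] x /= fx0; first by rewrite fx0.
move=> /andP[/andP[_ /eqP sgb] alt_s]; rewrite fx0 /=.
by apply: IHs => //; rewrite -sgr_eq0 sgb oppr_eq0 sgr_eq0.
Qed.

Lemma alternating_sgr f F k e x s :
    {in x :: s, forall t, Num.sg F.[t] = k * Num.sg f.[t]} ->
  alternating f e x s -> alternating F e x s.
Proof.
elim: s x => //= b s IHs x sgF /andP[/andP[-> /eqP sgb] alt_s] /=.
rewrite !sgF ?mem_head ?in_cons ?eqxx ?orbT // sgb mulrN eqxx /=.
by apply: IHs => // t ts; apply: sgF; rewrite in_cons ts orbT.
Qed.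

Lemma alternating_head f e x y s :
    all (fun t => e * y < e * t) s -> Num.sg f.[y] = Num.sg f.[x] ->
  alternating f e x s -> alternating f e y s.
Proof.
by case: s => //= b s /andP[-> _] -> /andP[/andP[_ ->] ->].
Qed.

Lemma sign_change_root f e a b : e != 0 -> e * a < e * b -> f.[a] != 0 ->
    Num.sg f.[b] = - Num.sg f.[a] ->
  exists r, [/\ e * a < e * r, e * r < e * b & root f r].
Proof.
move=> e0 ab fa0 sgb.
have fab : f.[a] * f.[b] < 0.
  by rewrite -sgr_lt0 sgrM sgb mulrN -expr2 sqr_sg fa0 oppr_lt0 ltr01.
case/lt_total/orP: e0 => e0.
  move: ab; rewrite ltr_nM2l // => ab.
  have [|r] := @poly_ivtoo _ f b a (ltW ab); first by rewrite mulrC.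
  by rewrite in_itv /= => /andP[br ra] fr; exists r; rewrite !ltr_nM2l.
move: ab; rewrite ltr_pM2l // => ab.
have [r] := poly_ivtoo (ltW ab) fab.
by rewrite in_itv /= => /andP[ar rb] fr; exists r; rewrite !ltr_pM2l.
Qed.

(** The intermediate value theorem gives a root between consecutive points; these intervals are
    disjoint, so the roots differ. *)
Lemma alternating_roots f e x s : e != 0 -> f.[x] != 0 ->
    alternating f e x s ->
  exists rs, [/\ size rs = size s, uniq rs, all (root f) rs
               & all (fun t => e * x < e * t) rs].
Proof.
move=> e0; elim: s x => [|b s IHs] x fx0 /=; first by exists [::].
move=> /andP[/andP[lt_xb /eqP sgb] alt_s].
have fb0 : f.[b] != 0 by rewrite -sgr_eq0 sgb oppr_eq0 sgr_eq0.
have [rs [sz Urs frs gt_rs]] := IHs _ fb0 alt_s.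
have [r [xr rb fr]] := sign_change_root e0 lt_xb fx0 sgb.
exists (r :: rs); split=> /=; rewrite ?sz ?fr ?xr //.
  rewrite Urs andbT; apply/negP => /(allP gt_rs).
  by rewrite ltNge (ltW rb).
by apply: sub_all gt_rs => t; exact: lt_trans.
Qed.

Definition has_alternation f e n :=
  exists2 s, size s = n & alternating f e 0 s.

Lemma sgr_near (v w : R) : v != 0 -> exists2 d : R, 0 < d &
  forall c, `|c| < d -> Num.sg (v - c * w) = Num.sg v.
Proof.
move=> v0; have w1 : 0 < `|w| + 1 by rewrite ltr_wpDl.
exists (`|v| / (`|w| + 1)) => [|c]; first by rewrite divr_gt0 ?normr_gt0.
rewrite ltr_pdivlMr // => lt_c.
have {lt_c} : `|c * w| < `|v|.
  by apply: le_lt_trans lt_c; rewrite normrM ler_wpM2l // lerDl.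
case: (ltrgt0P v) v0 => // v0 _; rewrite ltr_norml => /andP[l1 l2].
  by rewrite !gtr0_sg //; lra.
by rewrite !ltr0_sg //; lra.
Qed.

Lemma sgr_perturbation f q s : all (fun t => f.[t] != 0) s ->
  exists2 d : R, 0 < d & forall c, `|c| < d ->
    {in s, forall t, Num.sg (f - c *: q).[t] = Num.sg f.[t]}.
Proof.
elim: s => [_|x s IHs /= /andP[fx0 /IHs[d d0 Hd]]]; first by exists 1.
have [d' d'0 Hd'] := sgr_near q.[x] fx0.
exists (Num.min d d') => [|c]; first by rewrite lt_min d0.
rewrite lt_min => /andP[cd cd'] t; rewrite in_cons => /predU1P[->|]; last exact: Hd.
by rewrite !hornerE Hd'.
Qed.

Lemma small_with_sign (sg d : R) : 0 < d -> sg != 0 ->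
  exists2 c, `|c| < d & Num.sg c = Num.sg sg.
Proof.
move=> d0 sg0; exists (Num.sg sg * (d / 2)).
  rewrite normrM normr_sg sg0 mul1r gtr0_norm ?divr_gt0 //; lra.
by rewrite sgrM sgr_id (gtr0_sg (divr_gt0 d0 _)) // mulr1.
Qed.

(** Makes room for inserting new points between 0 and the old ones. *)
Lemma sgr_near0 f s : f.[0] != 0 -> all (fun t => t != 0) s ->
  exists d : R, [/\ 0 < d, forall y, `|y| <= d -> Num.sg f.[y] = Num.sg f.[0]
    & {in s, forall t, d < `|t|}].
Proof.
move=> f0; elim: s => [_|x s IHs /= /andP[x0 /IHs[d [d0 Hd Hs]]]].
  have [|d d0 Hd] := @poly_cont _ 0 f `|f.[0]|; first by rewrite normr_gt0.
  exists (d / 2); split=> [|y yd|//]; first by rewrite divr_gt0.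
  have /Hd : `|y - 0| < d by rewrite subr0; lra.
  case: (ltrgt0P f.[0]) f0 => // v0 _; rewrite ltr_norml => /andP[l1 l2].
    by rewrite !gtr0_sg //; lra.
  by rewrite !ltr0_sg //; lra.
have [xx0 d2 x2] : [/\ 0 < `|x|, d / 2 < d & `|x| / 2 < `|x|].
  by rewrite normr_gt0 x0; split=> //; [lra|move: x0; rewrite -normr_gt0; lra].
exists (Num.min d (`|x| / 2)); split=> [|y|t].
- by rewrite lt_min d0 divr_gt0.
- by rewrite le_min => /andP[/Hd].
- rewrite in_cons => /predU1P[->|/Hs dt]; rewrite gt_min ?x2 ?orbT //.
  by rewrite dt.
Qed.

Lemma has_alternation_perturbation f q m n : f.[0] != 0 ->
    has_alternation f 1 m -> has_alternation f (-1) n ->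
  exists2 d : R, 0 < d & forall c, `|c| < d ->
    [/\ Num.sg (f - c *: q).[0] = Num.sg f.[0],
        has_alternation (f - c *: q) 1 m & has_alternation (f - c *: q) (-1) n].
Proof.
move=> f0 [M sM altM] [N sN altN].
have [|d d0 Hd] := @sgr_perturbation f q (0 :: M ++ N).
  move: (alternating_neq0 f0 altM) (alternating_neq0 f0 altN) => /=.
  by rewrite f0 all_cat /= => -> ->.
exists d => // c /Hd sgF; split; first by apply: sgF; rewrite mem_head.
  exists M => //; apply: (@alternating_sgr f _ 1) altM => t tM.
  rewrite mul1r; apply: sgF.
  by move: tM; rewrite !in_cons mem_cat => /orP[->//|->]; rewrite orbT.
exists N => //; apply: (@alternating_sgr f _ 1) altN => t tN.
rewrite mul1r; apply: sgF.
by move: tN; rewrite !in_cons mem_cat => /orP[->//|->]; rewrite !orbT.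
Qed.

Lemma alternating_dir_neq0 f e s : alternating f e 0 s ->
  all (fun t => t != 0) s.
Proof.
by move/alternating_gt; apply: sub_all => t; apply: contraTneq => ->; rewrite ltxx.
Qed.

Lemma alternating_insert1 f F e k T s :
    0 < e * T -> {in s, forall t, e * T < e * t} ->
    Num.sg f.[T] = Num.sg f.[0] ->
    Num.sg F.[0] = - (k * Num.sg f.[0]) ->
    {in T :: s, forall t, Num.sg F.[t] = k * Num.sg f.[t]} ->
  alternating f e 0 s -> alternating F e 0 (T :: s).
Proof.
move=> T0 Ts sgT sgF0 sgF alt_s.
rewrite /alternating /= mulr0 T0 sgF0 opprK sgF ?mem_head // sgT eqxx /=.
apply: (alternating_sgr sgF); apply: alternating_head alt_s => //.
exact/allP.
Qed.

Lemma alternating_insert2 f F e k T1 T2 s :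
    0 < e * T1 -> e * T1 < e * T2 -> {in s, forall t, e * T2 < e * t} ->
    Num.sg f.[T2] = Num.sg f.[0] ->
    Num.sg F.[0] = k * Num.sg f.[0] ->
    Num.sg F.[T1] = - (k * Num.sg f.[0]) ->
    {in T2 :: s, forall t, Num.sg F.[t] = k * Num.sg f.[t]} ->
  alternating f e 0 s -> alternating F e 0 [:: T1, T2 & s].
Proof.
move=> T10 T12 Ts sgT sgF0 sgF1 sgF alt_s.
rewrite /alternating /= mulr0 T10 T12 sgF0 sgF1 opprK sgF ?mem_head // sgT !eqxx /=.
apply: (alternating_sgr sgF); apply: alternating_head alt_s => //.
exact/allP.
Qed.

(* Multiplying by ['X] creates a root at [0]; the correction [- c q] moves it
   to the side of [0] determined by the sign [c f(0) q(0)]. *)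
Lemma has_alternation_mulX f q (sg kappa : R) m n :
    sg != 0 -> f.[0] != 0 -> q.[0] != 0 -> kappa = Num.sg (f.[0] * q.[0]) ->
    has_alternation f 1 m -> has_alternation f (-1) n ->
  exists c, let F := 'X * f - c *: q in
    [/\ Num.sg c = Num.sg sg, F.[0] != 0,
        has_alternation F 1 (m + (Num.sg sg * kappa == 1)) &
        has_alternation F (-1) (n + (Num.sg sg * kappa == -1))].
Proof.
move=> sg0 f0 q0 ->{kappa} [M sM altM] [N sN altN].
have [|d [d0 Hd ltd]] := @sgr_near0 f (M ++ N) f0.
  by rewrite all_cat (alternating_dir_neq0 altM) (alternating_dir_neq0 altN).
have sgd y : `|y| = d -> Num.sg f.[y] = Num.sg f.[0] by move=> yd; rewrite Hd ?yd.
have fM0 := alternating_neq0 f0 altM; have fN0 := alternating_neq0 f0 altN.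
have nd : `|d| = d by rewrite gtr0_norm.
have [|d' d'0 Hd'] := @sgr_perturbation ('X * f) q (d :: - d :: M ++ N).
  apply/allP => t t_in; rewrite !hornerE mulf_neq0 //.
    move: t_in; rewrite !inE mem_cat.
    case/or4P => [/eqP->|/eqP->|tM|tN].
    - by rewrite gt_eqF.
    - by rewrite oppr_eq0 gt_eqF.
    - exact: (allP (alternating_dir_neq0 altM)).
    - exact: (allP (alternating_dir_neq0 altN)).
  move: t_in; rewrite !inE mem_cat.
  case/or4P => [/eqP->|/eqP->|tM|tN].
  - by rewrite -sgr_eq0 sgd ?sgr_eq0.
  - by rewrite -sgr_eq0 sgd ?sgr_eq0 ?normrN.
  - by apply: (allP fM0); rewrite inE tM orbT.
  - by apply: (allP fN0); rewrite inE tN orbT.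
have [c cd' sgc] := small_with_sign d'0 sg0.
exists c => F; have {cd'}Hd' := Hd' _ cd'.
have F0 : F.[0] = - (c * q.[0]) by rewrite /F !hornerE ?mul0r ?sub0r.
have c0 : c != 0 by rewrite -sgr_eq0 sgc sgr_eq0.
have sgF0 : Num.sg F.[0] = - (Num.sg sg * Num.sg (f.[0] * q.[0]) * Num.sg f.[0]).
  have f2 : Num.sg f.[0] ^+ 2 = 1 by rewrite sqr_sg f0.
  by rewrite F0 sgrN !sgrM sgc; ring: f2.
have sgFp : {in d :: M, forall t, Num.sg F.[t] = 1 * Num.sg f.[t]}.
  move=> t tM; rewrite Hd'.
    rewrite hornerM hornerX sgrM; congr (_ * _); apply: gtr0_sg.
    move: tM; rewrite inE => /predU1P[->//|/(allP (alternating_gt altM))].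
    by rewrite !mul1r.
  by move: tM; rewrite !inE mem_cat => /orP[->//|->]; rewrite !orbT.
have sgFn : {in - d :: N, forall t, Num.sg F.[t] = -1 * Num.sg f.[t]}.
  move=> t tN; rewrite Hd'.
    rewrite hornerM hornerX sgrM; congr (_ * _); apply: ltr0_sg.
    move: tN; rewrite inE => /predU1P[->|/(allP (alternating_gt altN))].
      by rewrite oppr_lt0.
    by rewrite mulr0 mulN1r oppr_gt0.
  by move: tN; rewrite !inE mem_cat => /orP[->//|->]; rewrite !orbT.
have sF0 : F.[0] != 0 by rewrite F0 oppr_eq0 mulf_neq0.
have ltM : {in M, forall t, 1 * d < 1 * t}.
  move=> t tM; have := allP (alternating_gt altM) _ tM; rewrite !mul1r => t0.
  by rewrite -(gtr0_norm t0) ltd // mem_cat tM.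
have ltN : {in N, forall t, -1 * - d < -1 * t}.
  move=> t tN; have := allP (alternating_gt altN) _ tN.
  rewrite mulr0 !mulN1r opprK oppr_gt0 => t0.
  by rewrite -(ltr0_norm t0) ltd // mem_cat tN orbT.
have : Num.sg sg * Num.sg (f.[0] * q.[0]) != 0.
  by rewrite mulf_neq0 // sgr_eq0 ?mulf_neq0.
move: sgF0; rewrite -sgrM; set e := Num.sg (sg * _) => sgF0 e0.
have e1 : e = 1 \/ e = -1.
  move: e0; rewrite /e sgr_eq0; case: sgrP => // *; [by left|by right].
(* The factor ['X] keeps the signs of [f] on the right and reverses them on the left. If [e] is 1,
   the sign at 0 disagrees with the right side, which gains the point [d]; if [e] is -1, it
   disagrees with the left side, which gains [- d]. *)
case: e1 sgF0 => ->; rewrite ?eqxx ?[1 == -1]eq_sym ?(negPf (oner_neq0 _)) => sgF0.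
  have -> : (-1 == 1 :> R) = false by apply/negbTE; rewrite eq_sym; apply/eqP; lra.
  split=> //.
    exists (d :: M); first by rewrite /= sM addn1.
    by apply: (alternating_insert1 (k := 1)) altM => //; rewrite ?mul1r ?sgd.
  exists N; first by rewrite addn0.
  apply: (@alternating_sgr f _ (-1)) altN => t; rewrite inE => /predU1P[->|tN].
    by rewrite sgF0 mulN1r mul1r.
  by apply: sgFn; rewrite inE tN orbT.
have -> : (-1 == 1 :> R) = false by apply/eqP; lra.
split=> //.
  exists M; first by rewrite addn0.
  apply: (@alternating_sgr f _ 1) altM => t; rewrite inE => /predU1P[->|tM].
    by rewrite sgF0 mulN1r mul1r opprK.
  by apply: sgFp; rewrite inE tM orbT.
exists (- d :: N); first by rewrite /= sN addn1.
apply: (alternating_insert1 (k := -1)) altN => //.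
  by rewrite mulrNN mul1r.
by rewrite sgd ?normrN.
Qed.

(** The quadratic factor is negative only between its two roots, which lie closer to 0 than all old
    points; so the signs at 0 and at the old points do not change. *)
Lemma has_alternation_mul2 f e m n : f.[0] != 0 -> e * e = 1 ->
    has_alternation f e m -> has_alternation f (- e) n ->
  exists2 d : R, 0 < d & let F := ('X - (e * d * 2)%:P) * ('X - (e * d * 3)%:P) * f in
    [/\ Num.sg F.[0] = Num.sg f.[0], has_alternation F e m.+2
      & has_alternation F (- e) n].
Proof.
move=> f0 e2 [M sM altM] [N sN altN].
have [|d4 [d40 Hd ltd]] := @sgr_near0 f (M ++ N) f0.
  by rewrite all_cat (alternating_dir_neq0 altM) (alternating_dir_neq0 altN).
have [d d4E d0] : exists2 d : R, d4 = d * 4 & 0 < d.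
  by exists (d4 / 4); lra.
exists d => // F.
have ne : `|e| = 1.
  by apply/eqP; rewrite -(@eqrXn2 _ 2) // expr1n -normrX expr2 e2 normr1.
have FE t : F.[t] = (e * t - d * 2) * (e * t - d * 3) * f.[t].
  by rewrite /F !hornerE; ring: e2.
have sgF0 : Num.sg F.[0] = 1 * Num.sg f.[0].
  by rewrite FE sgrM; congr (_ * _); apply: gtr0_sg; nra.
have gt4 t : d4 < `|t| -> Num.sg F.[t] = 1 * Num.sg f.[t].
  move=> dt; rewrite FE sgrM; congr (_ * _); apply: gtr0_sg.
  have : d * 4 < `|e * t| by rewrite normrM ne mul1r -d4E.
  by case: (lerP 0 (e * t)) => et; [rewrite ger0_norm|rewrite ltr0_norm] => // h; nra.
split; first by rewrite sgF0 mul1r.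
  (* Up to [e], the first point is the midpoint of the roots [2 d] and [3 d], where the sign of [f]
     is reversed; at [4 d] it is restored. *)
  exists [:: e * (d * 5 / 2), e * (d * 4) & M]; first by rewrite /= sM.
  have eK x : e * (e * x) = x by rewrite mulrA e2 mul1r.
  apply: (alternating_insert2 (k := 1)) (altM); rewrite ?eK.
  - lra.
  - lra.
  - move=> t tM; rewrite -d4E.
    have := allP (alternating_gt altM) _ tM; rewrite mulr0 => t0.
    by rewrite -[e * t]gtr0_norm // normrM ne mul1r ltd // mem_cat tM.
  - by rewrite Hd // normrM ne mul1r gtr0_norm ?d4E //; lra.
  - exact: sgF0.
  - rewrite FE eK sgrM mul1r ltr0_sg ?mulN1r ?Hd //; last nra.
    by rewrite normrM ne mul1r gtr0_norm ?d4E; lra.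
  move=> t; rewrite inE => /predU1P[->|tM].
    by rewrite FE eK sgrM gtr0_sg //; nra.
  by rewrite gt4 // ltd // mem_cat tM.
exists N => //; apply: (@alternating_sgr f _ 1) (altN) => t.
rewrite inE => /predU1P[->//|tN].
by rewrite gt4 // ltd // mem_cat tN orbT.
Qed.

End Alternation.

(** * Polynomials of weighted paths and their numbers of positive roots *)

Section Continuant.
Variable R : rcfType.
Implicit Types (l s : seq R) (f q : {poly R}).

(* In the variable [y = x^2], dropping the factor [x] from characteristic
   polynomials of odd degree: the polynomials of a weighted path and of the path
   without its first vertex.  There is one weight per vertex, that of the edge
   to the next vertex; the last weight is irrelevant. *)
Fixpoint continuant l : {poly R} * {poly R} :=
  if l is a :: l' then
    let f := (continuant l').1 in
    ((if odd (size l') then 'X * f else f) - a *: (continuant l').2, f)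
  else (1, 0).

(** The degree serves later to show that the roots found from alternations are all the roots. *)
Lemma continuant_monic l :
  [/\ (continuant l).1 \is monic,
      size (continuant l).1 = (size l)./2.+1 &
      (size (continuant l).2 <= uphalf (size l))%N].
Proof.
elim: l => [|a l [mf sf sq]] /=; first by rewrite monic1 size_poly1 size_poly0.
set f := (continuant l).1 in mf sf *; set q := (continuant l).2 in sq *.
set g := if _ then _ else _.
have mg : g \is monic by rewrite /g; case: ifP => // _; rewrite monicMl ?monicX.
have sg : size g = (size l).+1./2.+1.
  rewrite /g -[(size l).+1./2]/(uphalf (size l)) uphalf_half; case: ifP => // _.
  by rewrite mulrC size_mulX ?monic_neq0 ?sf.
have lt_qg : (size (- (a *: q)) < size g)%N.
  rewrite size_polyN (leq_ltn_trans (size_scale_leq _ _)) //.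
  by rewrite (leq_ltn_trans sq) // sg.
rewrite monicE lead_coefDl // -monicE mg size_polyDl // sg sf.
by split=> //; rewrite uphalfE /=; lia.
Qed.

(* [f] has [p] positive and [n] negative roots and no others; for odd paths,
   [kappa] decides with which sign the next edge creates a root near 0. *)
Definition signature l (p : nat) (kappa : R) :=
  let f := (continuant l).1 in
  [/\ f.[0] != 0,
      odd (size l) -> Num.sg (f.[0] * (continuant l).2.[0]) = kappa &
      exists n : nat, [/\ (n + p = (size l)./2)%N, has_alternation f 1 p
                  & has_alternation f (-1) n]].

Definition same_signs l s := all2 (fun w t => Num.sg w == Num.sg t) l s.

Lemma same_signs_cat l1 l2 s1 s2 :
  same_signs l1 s1 -> same_signs l2 s2 -> same_signs (l1 ++ l2) (s1 ++ s2).
Proof.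
rewrite /same_signs !all2E !size_cat => /andP[/eqP sz1 all1] /andP[/eqP sz2 all2].
by rewrite zip_cat // all_cat sz1 sz2 eqxx all1.
Qed.

Lemma signature_nil : signature [::] 0%N 1.
Proof.
by split; rewrite /= ?hornerC ?oner_neq0 //; exists 0%N; split=> //; exists [::].
Qed.

(** If [l] is odd, the degree rises and the new root near 0 is counted when positive; if [l] is
    even, the degree stays and [f] is only perturbed. The new parameter is 1 since it is constrained
    only in the second case, where the new polynomial and [f] have equal signs at 0. *)
Lemma signature_cons l p kappa t : kappa != 0 -> t != 0 ->
    signature l p kappa ->
  exists2 a, Num.sg a = Num.sg t &
    signature (a :: l) (p + (odd (size l) && (Num.sg t * kappa == 1))) 1.
Proof.
move=> k0 t0; rewrite /signature /=.
move: (continuant l) => [f q] /= [f0 kappaE [n [np altp altn]]].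
case: ifP kappaE => [odd_l /(_ isT) kappaE|even_l _] /=.
  have q0 : q.[0] != 0.
    by apply: contraNneq k0 => q0; rewrite -kappaE q0 mulr0 sgr0.
  have [c [sgc F0 altFp altFn]] :=
    has_alternation_mulX t0 f0 q0 (esym kappaE) altp altn.
  exists c => //; split=> //.
  exists (n + (Num.sg t * kappa == -1)%R)%N; split=> //.
  have : Num.sg t * kappa = 1 \/ Num.sg t * kappa = -1.
    rewrite -kappaE -sgrM; case: sgrP => [/eqP| |]; [|by left|by right].
    by rewrite !mulf_eq0 (negPf t0) (negPf f0) (negPf q0).
  have n11 : (1 == -1 :> R) = false by apply/eqP; lra.
  by case=> ->; rewrite ?eqxx ?n11 ?[-1 == 1]eq_sym ?n11 /=; lia.
have [d d0 Hd] := has_alternation_perturbation q f0 altp altn.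
have [c cd sgc] := small_with_sign d0 t0.
have [sgF0 altFp altFn] := Hd c cd.
exists c => //; rewrite addn0; split.
- by rewrite -sgr_eq0 sgF0 sgr_eq0.
- by move=> _; rewrite sgrM sgF0 -expr2 sqr_sg f0.
by exists n; split=> //; rewrite np; lia.
Qed.

Lemma block_weights (e t d : R) : e * e = 1 -> t != 0 -> 0 < d ->
  exists e1 e2 e3 : R,
    [/\ Num.sg e1 = Num.sg t, Num.sg e2 = - Num.sg t, Num.sg e3 = Num.sg t,
        e1 + e2 + e3 = e * d * 2 + e * d * 3 &
        e1 * e3 = (e * d * 2) * (e * d * 3)].
Proof.
move=> ee t0 d0.
have [x -> xx] : exists2 x : R, Num.sg t = x & x * x = 1.
  by exists (Num.sg t) => //; rewrite -expr2 sqr_sg t0.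
have sq1 (y : R) : y * y = 1 -> y = 1 \/ y = -1.
  move=> yy; have /eqP : (y - 1) * (y + 1) = 0 by ring: yy.
  by rewrite mulf_eq0 => /orP[] /eqP h; [left|right]; lra.
have sgx : Num.sg x = x by case: (sq1 x xx) => ->; rewrite ?sgrN sgr1.
(* The outer weights have the required product because [x] and [e] square to 1. The sum then fixes
   the middle weight, whose sign is that of [- x] because 7 exceeds 5. *)
exists (6 * x * d), (5 * e * d - 7 * x * d), (x * d); split.
- by rewrite !sgrM sgx !gtr0_sg ?mulr1 ?mul1r.
- by case: (sq1 x xx) => ->; case: (sq1 e ee) => ->;
    [rewrite ltr0_sg|rewrite ltr0_sg|rewrite gtr0_sg|rewrite gtr0_sg]; lra.
- by rewrite sgrM sgx gtr0_sg ?mulr1.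
- by ring.
- by ring: ee xx.
Qed.

(** With connecting weight 0 the three edges would multiply [f] exactly by the quadratic with roots
    [2 e d] and [3 e d]; a tiny weight only perturbs this. The new parameter does not involve [e],
    so later edges treat both choices of [e] alike. *)
Lemma signature_block l p kappa (e t y z c : R) :
    Num.sg y = - Num.sg t -> Num.sg z = Num.sg t ->
    e * e = 1 -> kappa != 0 -> t != 0 -> c != 0 -> signature l p kappa ->
  exists2 b, same_signs b [:: t; y; z; c] &
    signature (b ++ l) (p + (e == 1).*2) (- Num.sg t * Num.sg c * kappa).
Proof.
move=> sgy sgz ee k0 t0 c0; rewrite /signature /=.
case fqE: (continuant l) => [f q] /= [f0 kappaE [n [np altp altn]]].
have e1 : e = 1 \/ e = -1.
  have /eqP : (e - 1) * (e + 1) = 0 by ring: ee.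
  by rewrite mulf_eq0 => /orP[] /eqP h; [left|right]; lra.
have n11 : (-1 == 1 :> R) = false by apply/eqP; lra.
have [d d0] : exists2 d : R, 0 < d &
    let F := ('X - (e * d * 2)%:P) * ('X - (e * d * 3)%:P) * f in
    [/\ Num.sg F.[0] = Num.sg f.[0],
        has_alternation F 1 (p + (e == 1).*2) &
        has_alternation F (-1) (n + (e == -1).*2)].
  case: e1 => eE; rewrite eE.
    have [d d0 [? ? ?]] := has_alternation_mul2 f0 (mul1r 1) altp altn.
    exists d => // F; rewrite eqxx eq_sym n11 addn2 addn0; split=> //.
  have [||d d0 [? ? ?]] := @has_alternation_mul2 _ f (-1) n p f0 _ altn.
  - by rewrite mulrNN mulr1.
  - by rewrite opprK.
  exists d => // F; rewrite eqxx n11 addn2 addn0; split=> //.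
  by rewrite -[X in has_alternation _ X _]opprK.
set F := _ * _ * f => /= -[sgF0 altFp altFn].
have F0 : F.[0] != 0 by rewrite -sgr_eq0 sgF0 sgr_eq0.
have [w1 [w2 [w3 [sgw1 sgw2 sgw3 sumw prodw]]]] := block_weights ee t0 d0.
(* Expanding the recurrence four times, [r] collects what the connecting weight multiplies. *)
pose r := if odd (size l) then ('X - (w2 + w3)%:P) * q
          else ('X ^+ 2 - (w2 + w3)%:P * 'X) * q.
have rE c' : (continuant ([:: w3; w2; w1; c'] ++ l)).1 = F - c' *: r.
  have FE : F = ('X ^+ 2 - (w1 + w2 + w3)%:P * 'X + (w1 * w3)%:P) * f.
    by rewrite sumw prodw /F !(polyCD, polyCM); ring.
  rewrite FE /r /= fqE /= -!mul_polyC !negbK !polyCD polyCM.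
  by case: (odd (size l)) => /=; ring.
have [d' d'0 Hd'] := has_alternation_perturbation r F0 altFp altFn.
have [c' cd' sgc] := small_with_sign d'0 c0.
have [sgG0 altGp altGn] := Hd' c' cd'.
exists [:: w3; w2; w1; c'].
  by rewrite /same_signs /= sgw1 sgw2 sgw3 sgc sgy sgz !eqxx.
rewrite rE; split.
- by rewrite -sgr_eq0 sgG0 sgr_eq0.
- rewrite /= !negbK => odd_l; rewrite fqE /= odd_l.
  (* At 0 only the product of the middle weight, the connecting weight and [q] survives, which
     yields the new parameter. *)
  have -> : ('X * ('X * f - c' *: q - w1 *: f) - w2 *: ('X * f - c' *: q)).[0] =
      w2 * (c' * q.[0]).
    by rewrite !(hornerD, hornerN, hornerM, hornerZ, hornerX); ring.
  rewrite !sgrM sgG0 sgF0 sgw2 sgc -kappaE // sgrM; ring.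
exists (n + (e == -1)%R.*2)%N; split=> //; rewrite /= addnACA np.
rewrite -doubleD; suff -> : ((e == -1)%R + (e == 1)%R = 1)%N by rewrite addn2.
by case: e1 => ->; rewrite ?eqxx ?n11 // eq_sym n11.
Qed.

Lemma exists_signature s : all (fun t => t != 0) s ->
  exists l p, same_signs l s /\ signature l p 1.
Proof.
elim: s => [|t s IHs /= /andP[t0 /IHs[l [p [ls sig_l]]]]].
  by exists [::], 0%N; split=> //; exact: signature_nil.
have [a sga sig_a] := signature_cons (oner_neq0 R) t0 sig_l.
exists (a :: l); eexists; split; last exact: sig_a.
by rewrite /same_signs /= sga eqxx.
Qed.

Lemma distinct_signatures s1 s2 (t y z c : R) :
    all (fun t => t != 0) (s1 ++ [:: t, y, z, c & s2]) ->
    Num.sg y = - Num.sg t -> Num.sg z = Num.sg t ->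
  let s := s1 ++ [:: t, y, z, c & s2] in
  exists l1 l2 p1 p2 kappa1 kappa2,
    [/\ p1 != p2, same_signs l1 s, same_signs l2 s, signature l1 p1 kappa1
      & signature l2 p2 kappa2].
Proof.
rewrite all_cat /= => /andP[s1_neq0 /and5P[t0 y0 z0 c0 s2_neq0]] sgy sgz.
(* A common [kappa] is carried through the induction so that each further edge adds the same number
   of positive roots to both lists. *)
suff [kappa k0 [l1 [l2 [p1 [p2 [? ? ? ? ?]]]]]] : exists2 kappa, kappa != 0 &
    exists l1 l2 p1 p2, [/\ p1 != p2, same_signs l1 (s1 ++ [:: t, y, z, c & s2]),
      same_signs l2 (s1 ++ [:: t, y, z, c & s2]), signature l1 p1 kappa
      & signature l2 p2 kappa].
  by exists l1, l2, p1, p2, kappa, kappa.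
elim: s1 s1_neq0 => [_|u s1 IHs /= /andP[u0 /IHs[kappa k0]]] /=.
  (* Over one and the same tail, [e := 1] and [e := -1] give counts that differ by 2. *)
  have [l [p [ls sig_l]]] := exists_signature s2_neq0.
  have [b1 sb1 sig1] :=
    signature_block sgy sgz (mulr1 1) (oner_neq0 R) t0 c0 sig_l.
  have [|b2 sb2 sig2] :=
    signature_block (e := -1) sgy sgz _ (oner_neq0 R) t0 c0 sig_l.
    by rewrite mulrNN mulr1.
  exists (- Num.sg t * Num.sg c * 1).
    by rewrite !mulf_neq0 ?oppr_eq0 ?sgr_eq0 ?oner_neq0.
  exists (b1 ++ l), (b2 ++ l); eexists; eexists; split;
    last exact: sig2; last exact: sig1.
  - by rewrite eqxx eqn_add2l; have -> : (-1 == 1 :> R) = false by apply/eqP; lra.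
  - exact: (same_signs_cat sb1 ls).
  - exact: (same_signs_cat sb2 ls).
case=> l1 [l2 [p1 [p2 [p12 s_l1 s_l2 sig1 sig2]]]].
have [a1 sga1 sig_a1] := signature_cons k0 u0 sig1.
have [a2 sga2 sig_a2] := signature_cons k0 u0 sig2.
exists 1; first exact: oner_neq0.
exists (a1 :: l1), (a2 :: l2); eexists; eexists; split;
  last exact: sig_a2; last exact: sig_a1.
- have := s_l1; have := s_l2; rewrite /same_signs !all2E.
  by case/andP=> /eqP-> _ /andP[/eqP-> _]; rewrite eqn_add2r.
- by rewrite /same_signs /= sga1 eqxx.
- by rewrite /same_signs /= sga2 eqxx.
Qed.

(** * From positive roots to real roots with multiplicity *)

Lemma mup_prod_XsubC (zs : seq R) x :
  mup x (\prod_(z <- zs) ('X - z%:P)) = count_mem x zs.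
Proof.
elim: zs => [|z zs IHzs]; first by rewrite big_nil mupNroot // root1.
rewrite big_cons mupM ?polyXsubC_eq0 ?monic_neq0 ?monic_prod_XsubC // IHzs.
by rewrite -['X - _]expr1 mup_XsubCX /=; case: eqP.
Qed.

Lemma sum_count_mem (T : eqType) (r zs : seq T) :
  uniq r -> {subset zs <= r} -> (\sum_(x <- r) count_mem x zs)%N = size zs.
Proof.
move=> Ur; elim: zs => [|z zs IHzs] zs_r /=; first by rewrite big1.
rewrite big_split /= IHzs => [|x x_in]; last by rewrite zs_r // inE x_in orbT.
rewrite -add1n; congr addn; rewrite -big_mkcond /= sum1_count.
under eq_count do rewrite eq_sym.
by rewrite (count_uniq_mem _ Ur) zs_r ?mem_head.
Qed.

Lemma sum_mup_rootsR (zs : seq R) (u : {poly R}) :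
    u != 0 -> (forall x, ~~ root u x) ->
  let p := \prod_(z <- zs) ('X - z%:P) * u in
  (\sum_(x <- rootsR p) mup x p)%N = size zs.
Proof.
move=> u0 ur p; have p0 : p != 0.
  by rewrite mulf_neq0 // monic_neq0 // monic_prod_XsubC.
under eq_bigr do rewrite /p mupMl // mup_prod_XsubC.
apply: sum_count_mem => [|z z_in]; first exact: uniq_roots.
by rewrite -(roots_on_rootsR p0) in_itv /= /p rootM root_prod_XsubC z_in.
Qed.

(** Under the substitution of ['X^2], a positive root [z] of [f] yields the roots plus and minus
    [Num.sqrt z], and a negative one yields a factor without real roots; the extra ['X] contributes
    the root 0. *)
Lemma signature_sum_mup l p kappa : signature l p kappa ->
  let P := (if odd (size l) then 'X else 1) * ((continuant l).1 \Po 'X^2) in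
  (\sum_(x <- rootsR P) mup x P)%N = (odd (size l) + p.*2)%N.
Proof.
have [mf sf _] := continuant_monic l.
case; set f := (continuant l).1 in mf sf * => f0 _ [n [np [M sM altM] [N sN altN]]] P.
have [rs [szr Ur fr rs0]] := alternating_roots (oner_neq0 R) f0 altM.
have [|ns [szn Un fn ns0]] := alternating_roots _ f0 altN.
  by rewrite oppr_eq0 oner_neq0.
have {}rs0 : all (fun t => 0 < t) rs.
  by apply: sub_all rs0 => t; rewrite !mul1r.
have {}ns0 : all (fun t => t < 0) ns.
  by apply: sub_all ns0 => t; rewrite mulr0 mulN1r oppr_gt0.
(* The roots found are distinct and as many as the degree, so [f] splits. *)
have fE : f = \prod_(z <- rs ++ ns) ('X - z%:P).
  rewrite [LHS](@all_roots_prod_XsubC _ f (rs ++ ns)).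
  - by rewrite (eqP mf) scale1r.
  - by rewrite sf size_cat szr szn sM sN addnC np.
  - by rewrite all_cat fr.
  rewrite uniq_rootsE cat_uniq Ur Un andbT /=; apply/hasPn => z /(allP ns0) z0.
  by apply/negP => /(allP rs0); rewrite ltNge (ltW z0).
pose u := \prod_(z <- ns) ('X^2 - z%:P).
pose zs := nseq (odd (size l)) 0 ++ map Num.sqrt rs ++ map (fun t => - Num.sqrt t) rs.
have u_gt0 x : 0 < u.[x].
  rewrite horner_prod; elim: (ns) ns0 => [|z s IHs] /=; first by rewrite big_nil.
  move=> /andP[z0 /IHs]; rewrite big_cons; apply: mulr_gt0.
  by rewrite !hornerE; have := sqr_ge0 x; rewrite expr2; lra.
have PE : P = \prod_(z <- zs) ('X - z%:P) * u.
  rewrite /P fE big_cat /= comp_polyM /zs !big_cat /= !big_map -!mulrA.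
  congr (_ * _).
    by case: (odd _) => /=; rewrite ?big_nil // big_seq1 subr0.
  rewrite mulrA; congr (_ * _).
    rewrite rmorph_prod -big_split /=; apply: eq_big_seq => z /(allP rs0) z0.
    rewrite comp_polyB comp_polyX comp_polyC polyCN opprK -subr_sqr.
    by rewrite -[in RHS]polyC_exp sqr_sqrtr // ltW.
  rewrite rmorph_prod; apply: eq_bigr => z _ /=.
  by rewrite comp_polyB comp_polyX comp_polyC.
rewrite PE sum_mup_rootsR.
- by rewrite !size_cat size_nseq !size_map szr sM addnn.
- by apply/eqP => u0; have := u_gt0 0; rewrite u0 horner0 ltxx.
- by move=> x; rewrite /root gt_eqF.
Qed.

End Continuant.

(** * Characteristic polynomials of tridiagonal matrices *)

Definition tridiagonal_mx (R : pzRingType) n (u v : nat -> R) : 'M[R]_n :=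
  \matrix_(i, j) if j == i.+1 :> nat then u i
                 else if i == j.+1 :> nat then v j else 0.

(** Laplace expansion along the first row leaves two minors; the second has a single nonzero
    candidate in its first column and is expanded there. *)
Lemma char_poly_tridiagonal_rec (R : comNzRingType) n (u v : nat -> R) :
  char_poly (tridiagonal_mx n.+2 u v) =
    'X * char_poly (tridiagonal_mx n.+1 (u \o S) (v \o S))
    - (u 0%N * v 0%N) *: char_poly (tridiagonal_mx n (u \o S \o S) (v \o S \o S)).
Proof.
rewrite {1}/char_poly (expand_det_row _ ord0) big_ord_recl big_ord_recl /=.
rewrite [X in _ + (_ + X)]big1 ?addr0 => [|j _]; last first.
  by rewrite !mxE /= polyC0 oppr0 addr0 mul0r.
congr (_ + _).
  rewrite !mxE /= polyC0 subr0 mulr1n; congr (_ * _).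
  rewrite /cofactor /= expr0 mul1r; congr (\det _).
  by apply/matrixP=> i j; rewrite !mxE /= /bump /= !add1n !eqSS.
rewrite !mxE /= sub0r.
rewrite /cofactor (expand_det_col _ ord0) big_ord_recl /=.
rewrite [X in _ * (_ * (_ + X))]big1 ?addr0 => [|i _]; last first.
  by rewrite !mxE /= polyC0 oppr0 addr0 mul0r.
rewrite !mxE /= sub0r /cofactor /= !add0n expr0 mul1r expr1 mulN1r.
set d1 := \det _; set d2 := char_poly _.
have -> : d1 = d2.
  congr (\det _); apply/matrixP=> i j; rewrite !mxE /= /bump /= !add1n !eqSS.
  by [].
by rewrite -mul_polyC polyCM; ring.
Qed.

Lemma char_poly_tridiagonal (R : rcfType) (l : seq R) (u v : nat -> R) :
    (forall i, (i.+1 < size l)%N -> u i * v i = nth 0 l i) ->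
  char_poly (tridiagonal_mx (size l) u v) =
    (if odd (size l) then 'X else 1) * ((continuant l).1 \Po 'X^2).
Proof.
have [m] := ubnP (size l); elim: m => // m IHm in l u v *.
case: l => [|a [|b l]] /= lt_lm uvE.
- by rewrite /char_poly det_mx00 comp_polyC mulr1.
- rewrite /char_poly det_mx11 !mxE /= polyC0 subr0.
  by rewrite scaler0 subr0 comp_polyC mulr1.
rewrite char_poly_tridiagonal_rec.
rewrite (IHm (b :: l)) => [||i lt_i] /=; [|lia|by rewrite uvE].
rewrite (IHm l) => [||i lt_i] /=; [|lia|by rewrite uvE ?(nth_rcons, ltnS) //; lia].
rewrite uvE // negbK -!mul_polyC.
case: (odd (size l)) => /=;
  rewrite !(comp_polyB, comp_polyM, comp_polyX, comp_polyC); ring.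
Qed.

(** * Matrices of a sign pattern with prescribed edge weights *)

Definition sign_value (R : realType) (s : sign) : R :=
  match s with Pos => 1 | Neg => -1 | Zero => 0 end.

Lemma sign_value_opp (R : realType) s :
  sign_value R (sign_opp s) = - sign_value R s.
Proof. by case: s; rewrite /= ?oppr0 ?opprK. Qed.

Lemma sign_value_mul (R : realType) s t :
  sign_value R (sign_mul s t) = sign_value R s * sign_value R t.
Proof.
by case: s => /=; rewrite ?mul1r ?mul0r ?mulN1r ?sign_value_opp.
Qed.

Lemma sgr_sign_value (R : realType) s : Num.sg (sign_value R s) = sign_value R s.
Proof. by case: s; rewrite /= ?sgrN ?sgr1 ?sgr0. Qed.

Lemma sign_value_eq0 (R : realType) s : (sign_value R s == 0) = (s == Zero).
Proof. by case: s; rewrite /= ?oppr_eq0 ?oner_eq0 ?eqxx. Qed.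

Lemma sign_of_scale (R : realType) s (a : R) :
  0 < a -> sign_of (sign_value R s * a) = s.
Proof.
rewrite /sign_of => a0; case: s => /=.
- by rewrite mul1r gt_eqF // a0.
- by rewrite mulN1r oppr_eq0 gt_eqF // oppr_gt0 ltNge ltW.
by rewrite mul0r eqxx.
Qed.

Lemma sign_mul_neq0 s t : (sign_mul s t != Zero) = (s != Zero) && (t != Zero).
Proof. by case: s; case: t. Qed.

Section Realization.
Variables (R : realType) (n : nat) (P : 'M[sign]_n.+1).
Hypothesis P_irr : irreducible_tridiagonal P.
Hypothesis P_diag : zero_diagonal P.

Lemma nonzero_adjacent (i j : 'I_n.+1) :
  P i j != Zero -> (i = j.+1 :> nat) \/ (j = i.+1 :> nat).
Proof.
move=> Pij.
have ne_ij : i != j by apply: contraNneq Pij => ->; rewrite P_diag.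
have : ~~ (1 < `|i%:Z - j%:Z|)%N.
  by apply: contra Pij => /(proj1 P_irr) ->.
by move: ne_ij; rewrite -val_eqE /=; lia.
Qed.

(** The final 1 fills the slot of the last vertex, which has no next edge; being nonzero, it can
    serve as connecting weight of a block that ends there. *)
Definition edge_signs : seq R :=
  mkseq (fun i => if (i < n)%N
                  then sign_value R (edge_sign P (inord i) (inord i.+1)) else 1)
        n.+1.

Lemma edge_sign_neq0 i : (i < n)%N -> edge_sign P (inord i) (inord i.+1) != Zero.
Proof.
move=> lt_in; rewrite sign_mul_neq0.
by have [|-> ->] := proj2 P_irr (inord i) (inord i.+1); rewrite ?inordK ?ltnS // ltnW.
Qed.

Lemma edge_signs_neq0 : all (fun t => t != 0) edge_signs.
Proof.
apply/allP => _ /mapP[i _ ->]; case: ifP => [lt_in|_]; last exact: oner_neq0.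
by rewrite sign_value_eq0 edge_sign_neq0.
Qed.

Lemma realization l p kappa : same_signs l edge_signs -> signature l p kappa ->
  exists2 A : 'M[R]_n.+1, qual_class P A &
    num_real_eigenvalues A = (odd n.+1 + p.*2)%N.
Proof.
rewrite /same_signs all2E => /andP[/eqP sz_l /allP sg_l] sig_l.
rewrite size_mkseq in sz_l.
have {}sg_l i : (i < n)%N ->
    Num.sg l`_i = sign_value R (edge_sign P (inord i) (inord i.+1)).
  move=> lt_in; have lt_in1 : (i < n.+1)%N by rewrite ltnW.
  have := sg_l (l`_i, edge_signs`_i).
  rewrite -nth_zip ?size_mkseq // mem_nth ?size_zip ?size_mkseq ?sz_l ?minnn //.
  rewrite nth_zip ?size_mkseq //= nth_mkseq // lt_in sgr_sign_value.
  by move=> /(_ isT)/eqP.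
(* Entries above the diagonal have modulus 1 and those below carry the size, so that opposite
   entries multiply to the weight in [l]. *)
pose u i := sign_value R (P (inord i) (inord i.+1)).
pose v i := sign_value R (P (inord i.+1) (inord i)) * `|l`_i|.
exists (tridiagonal_mx n.+1 u v) => [i j|]; last first.
  rewrite /num_real_eigenvalues -sz_l char_poly_tridiagonal => [|i].
    exact: signature_sum_mup sig_l.
  rewrite sz_l ltnS => lt_in.
  by rewrite /u /v mulrA -sign_value_mul -sg_l // -numEsg.
rewrite mxE; case: eqP => [ji|/eqP ji].
  rewrite /u -ji !inord_val -[sign_value _ _]mulr1; exact: sign_of_scale.
case: eqP => [ij|/eqP ij].
  have lt_jn : (j < n)%N by rewrite -ltnS -ij.
  rewrite /v -ij !inord_val sign_of_scale // normr_gt0 -sgr_eq0 sg_l //.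
  by rewrite sign_value_eq0 edge_sign_neq0.
rewrite /sign_of eqxx; apply/esym/eqP; apply/negPn/negP => /nonzero_adjacent.
by case=> h; [move: ij|move: ji]; rewrite h eqxx.
Qed.

(* Rows and columns of a submatrix are chosen independently, but the nonzero
   entries of the path force them to be the same four consecutive indices. *)
Lemma path_submatrix (B : 'M[sign]_4) :
    (forall i j : 'I_4, j = i.+1 :> nat -> edge_sign B i j != Zero) ->
    submatrix B P ->
  exists k, [/\ (k + 3 < n.+1)%N &
    forall i j : 'I_4, P (inord (k + i)) (inord (k + j)) = B i j].
Proof.
move=> B0 [f [g [f_mono g_mono BE]]].
have adj (i j : 'I_4) : j = i.+1 :> nat ->
    (f i = (g j).+1 :> nat \/ g j = (f i).+1 :> nat) /\
    (f j = (g i).+1 :> nat \/ g i = (f j).+1 :> nat).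
  move=> /B0; rewrite sign_mul_neq0 => /andP[Bij Bji]; split;
    by apply: nonzero_adjacent; move: Bij Bji; rewrite -BE !mxE.
pose o (i : nat) : 'I_4 := inord i.
have oE i : (i < 4)%N -> o i = i :> nat by move=> ?; rewrite inordK.
have a01 := adj (o 0%N) (o 1%N) ltac:(by rewrite !oE).
have a12 := adj (o 1%N) (o 2%N) ltac:(by rewrite !oE).
have a23 := adj (o 2%N) (o 3%N) ltac:(by rewrite !oE).
have f01 : (f (o 0%N) < f (o 1%N))%N by apply: f_mono; rewrite !oE.
have f12 : (f (o 1%N) < f (o 2%N))%N by apply: f_mono; rewrite !oE.
have f23 : (f (o 2%N) < f (o 3%N))%N by apply: f_mono; rewrite !oE.
have g01 : (g (o 0%N) < g (o 1%N))%N by apply: g_mono; rewrite !oE.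
have g12 : (g (o 1%N) < g (o 2%N))%N by apply: g_mono; rewrite !oE.
have g23 : (g (o 2%N) < g (o 3%N))%N by apply: g_mono; rewrite !oE.
(* For [j] following [i], monotonicity leaves only [g j = f i + 1] and [f j = g i + 1]; being
   increasing, [f] and [g] then agree at [i] and at [j]. *)
have fgE (i : 'I_4) : f i = (f (o 0%N) + i)%N :> nat /\ g i = (f (o 0%N) + i)%N :> nat.
  have -> : i = o i by rewrite /o inord_val.
  case: i => [[|[|[|[|i]]]]] //= lt_i; rewrite oE //; lia.
exists (f (o 0%N)); split; first by have := ltn_ord (f (o 3%N)); rewrite (fgE _).1 oE.
move=> i j; rewrite -BE mxE -(fgE i).1 -(fgE j).2.
by rewrite !inord_val.
Qed.

End Realization.

(** * Inconsistency caused by three edges of alternating signs *)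

Lemma edge_sign_P4 (i j : 'I_4) : j = i.+1 :> nat ->
  edge_sign P4 i j = if i == 1%N :> nat then Neg else Pos.
Proof.
by case: i j => [[|[|[|[|i]]]] ?] [[|[|[|[|j]]]] ?] //= _; rewrite /edge_sign !mxE.
Qed.

(** The block matters only through its edge signs, so [Pos] for [sgn] covers [P4] and [Neg] covers
    every choice of its reversal. Indices start at 0, so 1 marks the middle edge. *)
Lemma inconsistent_of_alternating_path (R : realType) n (P : 'M[sign]_n)
    (B : 'M[sign]_4) (sgn : sign) :
    irreducible_tridiagonal P -> zero_diagonal P -> sgn != Zero ->
    (forall i j : 'I_4, j = i.+1 :> nat ->
       edge_sign B i j = if i == 1%N :> nat then sign_opp sgn else sgn) ->
  submatrix B P -> ~ consistent R P.
Proof.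
case: n P => [|n] P P_irr P_diag sgn0 BE subB; first by case: subB => f; case: (f ord0).
have [|k [lt_kn PB]] := path_submatrix P_irr P_diag _ subB.
  by move=> i j ij; rewrite BE //; case: ifP => // _; case: (sgn) sgn0.
pose es := edge_signs R P.
have esE (i : nat) : (i < 3)%N ->
    es`_(k + i) = sign_value R (if i == 1%N then sign_opp sgn else sgn).
  move=> lt_i; rewrite nth_mkseq; last by lia.
  have -> : (k + i < n)%N by lia.
  have ki (j : nat) : (j < 4)%N ->
      inord (k + j) = inord (k + (inord j : 'I_4)) :> 'I_n.+1.
    by move=> lt_j; rewrite [in RHS]inordK.
  have lt_i4 : (i < 4)%N by rewrite ltnW.
  rewrite -addnS (ki i) // (ki i.+1) // /edge_sign !PB -/(edge_sign B _ _).
  by rewrite BE !inordK.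
have szes : size es = n.+1 by rewrite size_mkseq.
(* The fourth entry is the edge leaving the block, or the final 1 if the block reaches the last
   vertex. *)
have esD : es = take k es ++ [:: es`_(k + 0), es`_(k + 1), es`_(k + 2), es`_(k + 3)
                              & drop (k + 4) es].
  rewrite -[LHS](cat_take_drop k) addn0 !addnS addn0.
  by rewrite 4?(drop_nth 0) ?szes //; lia.
have es0 := edge_signs_neq0 R P_irr; rewrite -/es esD in es0.
have [||l1 [l2 [p1 [p2 [c1 [c2 [ne_p s1 s2 sig1 sig2]]]]]]] := distinct_signatures es0.
- by rewrite !esE //= sign_value_opp sgrN.
- by rewrite !esE.
rewrite -esD in s1 s2.
have [A1 qA1 nA1] := realization P_irr P_diag s1 sig1.
have [A2 qA2 nA2] := realization P_irr P_diag s2 sig2.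
case=> m cP; move: ne_p; rewrite -(inj_eq double_inj) -(eqn_add2l (odd n.+1)).
by rewrite -nA1 -nA2 !cP // eqxx.
Qed.

Theorem theorem3p11 (R : realType) (n : nat) (P : 'M[sign]_n) :
  irreducible_tridiagonal P ->
  zero_diagonal P ->
  submatrix P4 P \/
    (exists Q : 'M[sign]_4, edge_sign_reversal P4 Q /\ submatrix Q P) ->
  ~ consistent R P.
Proof.
move=> P_irr P_diag [subP4|[Q [[_ QE] subQ]]].
  exact: (inconsistent_of_alternating_path (sgn := Pos) _ _ _ edge_sign_P4 subP4).
apply: (inconsistent_of_alternating_path (sgn := Neg) _ _ _ _ subQ) => // i j ij.
have P4ij := edge_sign_P4 ij.
rewrite QE ?P4ij; first by case: ifP.
rewrite /graph_edge -val_eqE /= ij ltn_eqF //=.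
have : edge_sign P4 i j != Zero by rewrite P4ij; case: ifP.
by rewrite sign_mul_neq0 => /andP[].
Qed.
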